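(* Let $\mathcal{T}=\mathrm{DEDICOM}(A,F,G)\in\mathbb{R}^{I\times I\times K}$ with $A\in\mathbb{R}^{I\times R}$, $F\in\mathbb{R}^{R\times R}$ symmetric, $G\in\mathbb{R}^{R\times K}$, and assume that (i) $\operatorname{rank}A=R$; (ii) $F$ has no zero entries; (iii) $\operatorname{rank}(G\odot G\odot G\odot G)=\binom{R+3}{4}$; (iv) $\operatorname{krank}(F)\ge2$ and $\operatorname{krank}(F^{\top})\ge2$. Then the rank-$R$ DEDICOM of $\mathcal{T}$ is essentially unique. In addition, $R$ is the minimal possible rank for a DEDICOM of $\mathcal{T}$ (i.e., $\mathcal{T}$ admits no rank-$R'$ DEDICOM with $R'<R$).
   Context: All matrices and tensors are real. A rank-$R$ DEDICOM (fully symmetric ParaTuck-2 decomposition) of $\mathcal{T}\in\mathbb{R}^{I\times I\times K}$, written $\mathcal{T}=\mathrm{DEDICOM}(A,F,G)$ with $A\in\mathbb{R}^{I\times R}$, $F\in\mathbb{R}^{R\times R}$ symmetric, $G\in\mathbb{R}^{R\times K}$, means that the frontal slices are $\mathcal{T}_{:,:,k}=A\,\mathrm{Diag}(g_k)\,F\,\mathrm{Diag}(g_k)\,A^{\top}$, $k=1,\ldots,K$, where $g_k$ is the $k$-th column of $G$. $\odot$ is the Khatri–Rao (columnwise Kronecker) product. $\operatorname{krank}(Z)$ is the Kruskal rank: the largest $k$ such that every $k$ columns of $Z$ are linearly independent. The rank-$R$ DEDICOM of $\mathcal{T}$ is essentially unique if for every alternative rank-$R$ DEDICOM $\mathcal{T}=\mathrm{DEDICOM}(\widetilde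 A,\widetilde F,\widetilde G)$ (with $\widetilde F$ symmetric) there exist a permutation matrix $\Pi\in\mathbb{R}^{R\times R}$ and nonsingular diagonal matrices $\Lambda_A,\Lambda_B,\Lambda_G,\Lambda_H\in\mathbb{R}^{R\times R}$, $\Lambda_{GH}\in\mathbb{R}^{K\times K}$ such that $$\widetilde A=A\Pi\Lambda_A=A\Pi\Lambda_B,\quad \widetilde F=\Pi^{\top}\Lambda_G^{-1}F\Lambda_H^{-1}\Pi,\quad \widetilde G=\Lambda_A^{-1}\Pi^{\top}\Lambda_G G\Lambda_{GH}=\Lambda_B^{-1}\Pi^{\top}\Lambda_H G\Lambda_{GH}^{-1}.$$ *)

(* Defs.v *)
From mathcomp Require Import all_boot all_order all_fingroup all_algebra.
From mathcomp Require Import mxtens.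
From mathcomp Require Import reals.

Set Implicit Arguments.
Unset Strict Implicit.
Unset Printing Implicit Defensive.

Import GRing.Theory.
Local Open Scope ring_scope.

Definition tensor3 (fT : Type) (I J K : nat) := 'I_I -> 'I_J -> 'I_K -> fT.

Definition frontal_slice (fT : Type) (I J K : nat) (T : tensor3 fT I J K)
    (k : 'I_K) : 'M[fT]_(I, J) :=
  \matrix_(i, j) T i j k.

(* [diag_mx] takes a row vector, hence the transpose of the column of [G]. *)
Definition is_dedicom (fT : fieldType) (I R K : nat) (T : tensor3 fT I I K)
    (A : 'M[fT]_(I, R)) (F : 'M[fT]_R) (G : 'M[fT]_(R, K)) : Prop :=
  F^T = F /\
  forall k : 'I_K,
    frontal_slice T k =
      A *m diag_mx (col k G)^T *m F *m diag_mx (col k G)^T *m A^T.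

(* [tensmx] of two column vectors has 1 * 1 columns, which computes to 1. *)
Definition khatri_rao (fT : fieldType) (m p n : nat)
    (X : 'M[fT]_(m, n)) (Y : 'M[fT]_(p, n)) : 'M[fT]_(m * p, n) :=
  \matrix_(i, j) tensmx (col j X) (col j Y) i ord0.

Definition columns_free (fT : fieldType) (m n : nat) (Z : 'M[fT]_(m, n))
    (S : {set 'I_n}) : bool :=
  row_free (colsub (fun i : 'I_#|S| => enum_val i) Z)^T.

(* The bound k <= n matters: for k > n there are no k columns to choose, and
   the condition would hold vacuously. *)
Definition krank (fT : fieldType) (m n : nat) (Z : 'M[fT]_(m, n)) : nat :=
  (\max_(k < n.+1 | [forall S : {set 'I_n}, (#|S| == k) ==> columns_free Z S])
     k)%N.

Definition nonsing_diag (fT : fieldType) (n : nat) (L : 'M[fT]_n) : bool :=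
  is_diag_mx L && (L \in unitmx).

Definition essentially_unique (fT : fieldType) (I R K : nat)
    (T : tensor3 fT I I K)
    (A : 'M[fT]_(I, R)) (F : 'M[fT]_R) (G : 'M[fT]_(R, K)) : Prop :=
  forall (A' : 'M[fT]_(I, R)) (F' : 'M[fT]_R) (G' : 'M[fT]_(R, K)),
    is_dedicom T A' F' G' ->
    exists (P LA LB LG LH : 'M[fT]_R) (LGH : 'M[fT]_K),
      [/\ is_perm_mx P,
          [/\ nonsing_diag LA, nonsing_diag LB, nonsing_diag LG,
              nonsing_diag LH & nonsing_diag LGH],
          A' = A *m P *m LA /\ A' = A *m P *m LB,
          F' = P^T *m invmx LG *m F *m invmx LH *m P
        & G' = invmx LA *m P^T *m LG *m G *m LGH /\
          G' = invmx LB *m P^T *m LH *m G *m invmx LGH].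

(* Main.v *)
Require Import Defs.
From mathcomp Require Import all_boot all_order all_fingroup all_algebra.
From mathcomp Require Import mxtens reals ring lra.

(** Let D_k and D'_k be the diagonal matrices of the columns k of G and G'.

    Comparing ranges. The rank of the fourfold Khatri-Rao product of G is the
    dimension of the space of quartic forms, so a quartic form vanishing at all
    columns of G is zero ([unisolvent4]); by squaring, the same holds for
    quadratic forms. As F has no zero entry, the D_k F D_k therefore span all
    symmetric matrices, so the column space of A can be recovered from the
    slices and lies in that of A' for any other decomposition: A = A' N
    ([dedicom_factor]). This gives the minimality of R, and when A' also has R
    columns, N is invertible and N D_k F D_k N^T = D'_k F' D'_k.

    N is monomial. Dividing the last equation entrywise by F' gives a matrix of
    rank one on the right, so the 2 x 2 minors of
    X(x) = (N D_x F D_x N^T) / F' vanish at the columns of G. They are quartic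
    in x, so X(x) has rank at most one for every x ([dedicom_rank1_pencil]). On
    the other hand x |-> X(x) comes from an invertible linear map on symmetric
    matrices, so its diagonal entries must be multiples of squares of linear
    forms ([rank1_pencil_diag]). Comparing coefficients, two nonzero entries in
    one row of N produce two proportional columns of F ([rank1_pencil_prop]),
    whereas F has Kruskal rank at least 2. So N is a permutation times a
    diagonal matrix.

    Scalings. Up to that permutation, G' a k G' b k F' a b and
    G a k G b k F a b now differ by a factor that does not depend on k. Hence F
    and F' differ by a rank one scaling, and G' is G with its rows rescaled, up
    to one sign for each column ([common_scaling]). These signs form
    Lambda_GH, which equals its inverse. *)

Set Implicit Arguments.
Unset Strict Implicit.
Unset Printing Implicit Defensive.

Import Order.TTheory GRing.Theory Num.Theory.

Local Open Scope ring_scope.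

(** * Kruskal rank *)

(** The sets of columns counted by the Kruskal rank may all be larger than 2, so
    a pair has to be completed to one of them before freeness applies. *)
Lemma krank_ge2_col (fT : fieldType) (m n : nat) (Z : 'M[fT]_(m, n))
    (i j : 'I_n) (c : fT) :
  (2 <= krank Z)%N -> i != j -> col j Z <> c *: col i Z.
Proof.
move=> hk neq_ij eq_ji.
have [k /andP[k_ge2 free_k]] : exists k : 'I_n.+1, (2 <= k)%N &&
    [forall S : {set 'I_n}, (#|S| == k) ==> columns_free Z S].
  apply/existsP; apply: contraLR hk; rewrite negb_exists -ltnNge ltnS.
  move=> /forallP h; apply/bigmax_leqP => k hS.
  by have := h k; rewrite hS andbT -ltnNge.
have c2 : #|[set i; j]| = 2 by rewrite cards2 neq_ij.
pose E := enum (~: [set i; j]).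
have sE : size E = (n - 2)%N.
  by rewrite -cardE cardsCs setCK card_ord c2.
pose S := [set i; j] :|: [set x in take (k - 2) E].
have cS : #|S| = k.
  rewrite cardsU (_ : _ :&: _ = set0) ?cards0 ?subn0.
    rewrite c2 cardsE (card_uniqP _) ?take_uniq ?enum_uniq // size_takel ?sE.
      by rewrite subnKC.
    by rewrite leq_sub2r // -ltnS.
  apply/setP=> x; rewrite !inE; apply/negP=> /andP[xij /mem_take].
  by rewrite mem_enum !inE xij.
have /implyP/(_ _) := forallP free_k S; rewrite cS eqxx => /(_ isT) frS.
pose v : 'rV[fT]_#|S| :=
  \row_s ((enum_val s == j)%:R - c * (enum_val s == i)%:R).
have v0 : v = 0.
  apply: (row_free_inj frS); rewrite mul0mx; apply/rowP=> l; rewrite !mxE.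
  under eq_bigr do rewrite !mxE mulrBl.
  have pick x (d : fT) : x \in S ->
      \sum_(s < #|S|) d * (enum_val s == x)%:R * Z l (enum_val s) = d * Z l x.
    move=> xS; rewrite (bigD1 (enum_rank_in xS x)) //= enum_rankK_in // eqxx.
    rewrite mulr1 big1 ?addr0 // => s neq_s.
    case: eqP => [es|_]; last by rewrite mulr0 mul0r.
    by case/eqP: neq_s; apply: enum_val_inj; rewrite enum_rankK_in.
  rewrite sumrB pick; last by rewrite !inE eqxx.
  under eq_bigr do rewrite -[X in X * _]mul1r.
  rewrite pick; last by rewrite !inE eqxx orbT.
  have := congr1 (fun M : 'cV_m => M l 0) eq_ji; rewrite !mxE => ->.
  by rewrite mul1r subrr.
have jS : j \in S by rewrite !inE eqxx orbT.
have := congr1 (fun M : 'rV_#|S| => M 0 (enum_rank_in jS j)) v0.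
rewrite !mxE enum_rankK_in // eqxx eq_sym (negPf neq_ij) mulr0 subr0.
by move/eqP; rewrite oner_eq0.
Qed.

(** * Forms determined by their values at the columns of a matrix *)

(** A homogeneous polynomial is presented as a list of terms, each a
    coefficient with the list of its variables. Repeated terms are allowed: sums
    and products are then concatenations and lists of pairs, with no collecting
    of monomials. *)
Definition is_form (fT : fieldType) (n d : nat) (f : 'rV[fT]_n -> fT) : Prop :=
  exists2 s : seq (fT * seq 'I_n), all (fun p => size p.2 == d) s
    & forall x, f x = \sum_(p <- s) p.1 * \prod_(i <- p.2) x 0 i.

Lemma is_form_coord (fT : fieldType) (n : nat) (i : 'I_n) :
  is_form 1 (fun x : 'rV[fT]_n => x 0 i).
Proof.
by exists [:: (1, [:: i])] => // x; rewrite !big_seq1 mul1r.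
Qed.

Lemma is_formD (fT : fieldType) (n d : nat) (f g : 'rV[fT]_n -> fT) :
  is_form d f -> is_form d g -> is_form d (fun x => f x + g x).
Proof.
move=> [s sd fE] [t td gE]; exists (s ++ t); first by rewrite all_cat sd.
by move=> x; rewrite big_cat fE gE.
Qed.

Lemma is_formZ (fT : fieldType) (n d : nat) (c : fT) (f : 'rV[fT]_n -> fT) :
  is_form d f -> is_form d (fun x => c * f x).
Proof.
move=> [s sd fE]; exists [seq (c * p.1, p.2) | p <- s].
  by rewrite all_map.
by move=> x; rewrite big_map fE mulr_sumr; apply: eq_bigr => p _; rewrite mulrA.
Qed.

Lemma is_formM (fT : fieldType) (n d e : nat) (f g : 'rV[fT]_n -> fT) :
  is_form d f -> is_form e g -> is_form (d + e) (fun x => f x * g x).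
Proof.
move=> [s sd fE] [t td gE].
exists [seq (p.1 * q.1, p.2 ++ q.2) | p <- s, q <- t].
  apply/allP=> _ /allpairsP[[p q] [/= ps qt ->]] /=.
  by rewrite size_cat (eqP (allP sd _ ps)) (eqP (allP td _ qt)).
move=> x; rewrite fE gE big_allpairs_dep big_distrl; apply: eq_bigr => p _ /=.
by rewrite big_distrr; apply: eq_bigr => q _ /=; rewrite big_cat /= mulrACA.
Qed.

Lemma is_form_sum (fT : fieldType) (n d : nat) (I : Type) (r : seq I)
    (f : I -> 'rV[fT]_n -> fT) :
  (forall i, is_form d (f i)) -> is_form d (fun x => \sum_(i <- r) f i x).
Proof.
move=> fd; elim: r => [|i r [s sd rE]].
  by exists [::] => // x; rewrite !big_nil.
have [t td fE] := fd i; exists (t ++ s); first by rewrite all_cat td.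
by move=> x; rewrite big_cons big_cat fE rE.
Qed.

Lemma eq_is_form (fT : fieldType) (n d : nat) (f g : 'rV[fT]_n -> fT) :
  f =1 g -> is_form d f -> is_form d g.
Proof. by move=> fg [s sd fE]; exists s => // x; rewrite -fg. Qed.

(** Rows of the fourfold Khatri-Rao product are indexed by nested pairs; this
    flattens them. *)
Definition kr_quad_index (n : nat) (i : 'I_(n * n * n * n)) : 4.-tuple 'I_n :=
  let p := mxtens_unindex i in
  let q := mxtens_unindex p.1 in
  let r := mxtens_unindex q.1 in [tuple r.1; r.2; q.2; p.2].

Lemma kr_quadE (fT : fieldType) (n K : nat) (G : 'M[fT]_(n, K)) i k :
  khatri_rao (khatri_rao (khatri_rao G G) G) G i k =
  \prod_(a <- kr_quad_index i) G a k.
Proof.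
by rewrite !mxE !big_cons big_nil /= mulr1 !mulrA.
Qed.

Lemma card_sorted_quads (n : nat) :
  #|[set t : 4.-tuple 'I_n | sorted leq (map val t)]| = 'C(n + 3, 4).
Proof.
case: n => [|n]; last by rewrite card_sorted_tuples addnC -addSnnS addnC.
by apply: eq_card0 => t; have := ltn_ord (thead t).
Qed.

Definition unisolvent (fT : fieldType) (n K : nat) (d : nat)
    (G : 'M[fT]_(n, K)) : Prop :=
  forall f, is_form d f -> (forall k, f (col k G)^T = 0) -> forall x, f x = 0.

(** Row i of the Khatri-Rao product depends only on the multiset of the four
    indices in i, so the product has the same row space as its submatrix B of
    sorted monomials. There are 'C(n + 3, 4) of these, so the rank hypothesis
    makes B row free: a combination of quartic monomials that vanishes at all
    columns of G is trivial. *)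
Lemma unisolvent4 (fT : fieldType) (n K : nat) (G : 'M[fT]_(n, K)) :
  \rank (khatri_rao (khatri_rao (khatri_rao G G) G) G) = 'C(n + 3, 4) ->
  unisolvent 4 G.
Proof.
move=> hG f [s sd fE] f0 x.
pose S := [set t : 4.-tuple 'I_n | sorted leq (map val t)].
pose leo : rel 'I_n := relpre val leq.
have sort_inS (t : 4.-tuple 'I_n) : sort_tuple leo t \in S.
  rewrite inE -(@sort_map _ _ val leq); apply: sort_sorted.
  exact: leq_total.
pose mono (y : 'rV[fT]_n) (m : 'I_#|S|) := \prod_(a <- enum_val m) y 0 a.
pose B : 'M[fT]_(#|S|, K) := \matrix_(m, k) mono (col k G)^T m.
pose srt t := enum_rank_in (sort_inS t) (sort_tuple leo t).
have srtE (y : 'rV[fT]_n) (t : 4.-tuple 'I_n) :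
    \prod_(a <- t) y 0 a = mono y (srt t).
  rewrite /mono enum_rankK_in //; apply: perm_big => /=.
  by rewrite perm_sym perm_sort.
have freeB : row_free B.
  rewrite -row_leq_rank; have := card_sorted_quads n.
  rewrite -hG -/S => cardS; apply: leq_trans (eq_leq cardS) (mxrankS _).
  apply/row_subP=> i; rewrite (_ : row i _ = row (srt (kr_quad_index i)) B).
    exact: row_sub.
  apply/rowP=> k; rewrite [LHS]mxE kr_quadE !mxE -srtE.
  by apply: eq_bigr => a _; rewrite !mxE.
have [v vE] : exists v : 'rV[fT]_#|S|, forall y, f y = \sum_m v 0 m * mono y m.
  elim: s f sd {f0} fE => [|p s IH] f /=.
    move=> _ fE; exists 0 => y; rewrite fE big_nil big1 // => m _.
    by rewrite mxE mul0r.
  case/andP=> sp ss fE; have [v vE] := IH _ ss (fun _ => erefl).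
  exists (v + p.1 *: delta_mx 0 (srt (Tuple sp))) => y.
  rewrite fE big_cons vE -[p.2]/(tval (Tuple sp)) srtE.
  under [RHS]eq_bigr do rewrite !mxE mulrDl.
  rewrite big_split /= addrC; congr (_ + _).
  rewrite (bigD1 (srt (Tuple sp))) //= !eqxx mulr1 big1 ?addr0 //.
  by move=> m /negPf ne; rewrite ne mulr0 mul0r.
rewrite vE; suff -> : v = 0 by rewrite big1 // => m _; rewrite mxE mul0r.
apply: (row_free_inj freeB); rewrite mul0mx; apply/rowP=> k.
rewrite !mxE; apply: etrans (f0 k); rewrite vE.
by apply: eq_bigr => m _; rewrite mxE.
Qed.

(** The square of a quadratic form is a quartic form. *)
Lemma unisolvent2 (fT : fieldType) (n K : nat) (G : 'M[fT]_(n, K)) :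
  unisolvent 4 G -> unisolvent 2 G.
Proof.
move=> hG f fd f0 x; apply/eqP; rewrite -[_ == _]orbb -mulf_eq0; apply/eqP.
by apply: (hG _ (is_formM fd fd)) => k /=; rewrite f0 mul0r.
Qed.

(** Otherwise the quartic monomial x_a x_b x_c ^ 2 would vanish at every column.
    No column of G need be nowhere zero when n > 4, hence the restriction to
    few indices. *)
Lemma unisolvent4_neq0 (fT : fieldType) (n K : nat) (G : 'M[fT]_(n, K))
    (a b c : 'I_n) : unisolvent 4 G ->
  exists k, [/\ G a k != 0, G b k != 0 & G c k != 0].
Proof.
move=> hG; have [k hk] : exists k, G a k * G b k * G c k != 0.
  apply/existsP; apply: contraT; rewrite negb_exists => /forallP abc0.
  have cf := @is_form_coord fT n.
  have fd := is_formM (is_formM (cf a) (cf b)) (is_formM (cf c) (cf c)).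
  have := hG _ fd _ (const_mx 1); rewrite !mxE !mulr1 => /(_ _)/eqP.
  rewrite oner_eq0; apply=> k; rewrite !mxE mulrA.
  by rewrite (eqP (negbNE (abc0 k))) mul0r.
by exists k; move: hk; rewrite !mulf_eq0 !negb_or => /andP[/andP[]].
Qed.

(** * The entries of N D F D N^T as quadratic forms in D *)

(** With D_x the diagonal matrix of x, the entry (a, b) of N D_x F D_x N^T is
    this form at x = y for u, v the rows a, b of N. Splitting x from y makes it
    bilinear in them, which is how it gets expanded along lines. *)
Definition hadform (fT : fieldType) (n : nat) (F : 'M[fT]_n)
    (u v x y : 'rV[fT]_n) : fT :=
  \sum_i \sum_j (u 0 i * x 0 i) * F i j * (v 0 j * y 0 j).

Lemma hadform_swap (fT : fieldType) (n : nat) (F : 'M[fT]_n)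
    (u v x y : 'rV[fT]_n) : hadform F u v x y = hadform F x y u v.
Proof.
apply: eq_bigr => i _; apply: eq_bigr => j _.
by congr (_ * _ * _); rewrite mulrC.
Qed.

Lemma hadformC (fT : fieldType) (n : nat) (F : 'M[fT]_n)
    (u v x y : 'rV[fT]_n) : F^T = F -> hadform F u v x y = hadform F v u y x.
Proof.
move=> symF; rewrite /hadform exchange_big; apply: eq_bigr => i _.
apply: eq_bigr => j _; rewrite -{1}symF mxE; ring.
Qed.

Lemma hadform_mx (fT : fieldType) (n : nat) (F : 'M[fT]_n)
    (u v x y : 'rV[fT]_n) :
  hadform F u v x y = (u *m diag_mx x *m F *m diag_mx y *m v^T) 0 0.
Proof.
rewrite /hadform exchange_big mxE; apply: eq_bigr => j _.
rewrite mul_mx_diag !mxE -mulrA big_distrl /=; apply: eq_bigr => i _.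
by rewrite mul_mx_diag mxE -!mulrA [v _ _ * _]mulrC.
Qed.

Lemma is_form_hadform (fT : fieldType) (n : nat) (F : 'M[fT]_n)
    (u v : 'rV[fT]_n) : is_form 2 (fun x => hadform F u v x x).
Proof.
apply: is_form_sum => i; apply: is_form_sum => j.
have := is_formM (is_form_coord fT i) (is_form_coord fT j).
move=> /(is_formZ (u 0 i * F i j * v 0 j)); apply: eq_is_form => x; ring.
Qed.

Lemma hadformDl (fT : fieldType) (n : nat) (F : 'M[fT]_n)
    (u v x x' y : 'rV[fT]_n) :
  hadform F u v (x + x') y = hadform F u v x y + hadform F u v x' y.
Proof. by rewrite !(hadform_swap F u v) !hadform_mx !mulmxDl mxE. Qed.

Lemma hadformDr (fT : fieldType) (n : nat) (F : 'M[fT]_n)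
    (u v x y y' : 'rV[fT]_n) :
  hadform F u v x (y + y') = hadform F u v x y + hadform F u v x y'.
Proof. by rewrite !(hadform_swap F u v) !hadform_mx linearD mulmxDr mxE. Qed.

Lemma hadformZl (fT : fieldType) (n : nat) (F : 'M[fT]_n)
    (u v x y : 'rV[fT]_n) (t : fT) :
  hadform F u v (t *: x) y = t * hadform F u v x y.
Proof. by rewrite !(hadform_swap F u v) !hadform_mx -!scalemxAl mxE. Qed.

Lemma hadformZr (fT : fieldType) (n : nat) (F : 'M[fT]_n)
    (u v x y : 'rV[fT]_n) (t : fT) :
  hadform F u v x (t *: y) = t * hadform F u v x y.
Proof. by rewrite !(hadform_swap F u v) !hadform_mx linearZ -scalemxAr mxE. Qed.

Lemma hadform_deltal (fT : fieldType) (n : nat) (F : 'M[fT]_n)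
    (u v y : 'rV[fT]_n) i :
  hadform F u v (delta_mx 0 i) y = u 0 i * \sum_j F i j * v 0 j * y 0 j.
Proof.
rewrite /hadform (bigD1 i) //= [X in _ + X]big1 ?addr0 => [|k /negPf ne_ki].
  by rewrite mulr_sumr; apply: eq_bigr => j _; rewrite mxE !eqxx mulr1 !mulrA.
by apply: big1 => j _; rewrite mxE ne_ki andbF mulr0 !mul0r.
Qed.

Lemma hadform_delta (fT : fieldType) (n : nat) (F : 'M[fT]_n)
    (u v : 'rV[fT]_n) i j :
  hadform F u v (delta_mx 0 i) (delta_mx 0 j) = u 0 i * F i j * v 0 j.
Proof.
rewrite hadform_deltal (bigD1 j) //= big1 ?addr0 => [|k /negPf ne_kj].
  by rewrite mxE !eqxx mulr1 mulrA.
by rewrite mxE ne_kj andbF mulr0.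
Qed.

(* Left transparent, the sums are unfolded by [ring] when it compares atoms. *)
Opaque hadform.

Lemma hadform_line (fT : fieldType) (n : nat) (F : 'M[fT]_n)
    (u v x y : 'rV[fT]_n) (t : fT) :
  hadform F u v (x + t *: y) (x + t *: y) =
    hadform F u v x x + (hadform F u v x y + hadform F u v y x) * t
    + hadform F u v y y * t ^+ 2.
Proof. rewrite !(hadformDl, hadformDr, hadformZl, hadformZr); ring. Qed.

(** The coefficient of x_i x_j is F i j (u_i v_j + u_j v_i): with j such that
    v_j != 0, i = j gives u_j = 0 and then the other i give u_i = 0. *)
Lemma hadform_eq0 (fT : numFieldType) (n : nat) (F : 'M[fT]_n)
    (u v : 'rV[fT]_n) : F^T = F -> (forall i j, F i j != 0) ->
  (forall x, hadform F u v x x = 0) -> v != 0 -> u = 0.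
Proof.
move=> symF nzF uv0 /rV0Pn[j vj].
have cross i : (u 0 i * v 0 j + u 0 j * v 0 i) = 0.
  apply: (mulfI (nzF i j)); rewrite mulr0.
  have := uv0 (delta_mx 0 i + 1 *: delta_mx 0 j).
  rewrite hadform_line !uv0 !hadform_delta -[in F j i]symF mxE => <-; ring.
have uj : u 0 j = 0.
  have /eqP := cross j; rewrite -mulr2n mulrn_eq0 mulf_eq0 (negPf vj) orbF.
  by move/eqP.
apply/rowP=> i; rewrite mxE; apply: (mulIf vj).
by have := cross i; rewrite uj !mul0r addr0.
Qed.

(** * Pencils of rank one *)

Lemma quartic_coef_eq0 (fT : realFieldType) (c0 c1 c2 c3 c4 : fT) :
  (forall t, c0 + c1 * t + c2 * t ^+ 2 + c3 * t ^+ 3 + c4 * t ^+ 4 = 0) ->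
  [/\ c0 = 0, c1 = 0, c2 = 0, c3 = 0 & c4 = 0].
Proof.
move=> h; have := (h 0, h 1, h (- 1), h 2, h (- 2)).
by case=> [[[[h0 h1] h2] h3] h4]; split; lra.
Qed.

(** If c ^ 2 = a b for binary quadratic forms, here with one variable set to 1,
    and a is not a multiple of a square, then a divides c. The conclusion only
    records that the first two coefficients of c are proportional to those of
    a. *)
Lemma sq_eq_mul (fT : realFieldType) (a0 a1 a2 b0 b1 b2 c0 c1 c2 : fT) :
  (forall t, (c0 + c1 * t + c2 * t ^+ 2) ^+ 2 =
     (a0 + a1 * t + a2 * t ^+ 2) * (b0 + b1 * t + b2 * t ^+ 2)) ->
  a0 != 0 -> a1 ^+ 2 != 4 * a0 * a2 -> c1 * a0 = c0 * a1.
Proof.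
move=> h a00 disc.
(* Subtracting from c the multiple m a that removes its constant term changes
   b into b - 2 m c + m ^ 2 a, which must then reduce to s t ^ 2. *)
have [m c0E] : exists m, c0 = m * a0 by exists (c0 / a0); rewrite divfK.
have [d c1E] : exists d, c1 = m * a1 + d by exists (c1 - m * a1); ring.
have [e c2E] : exists e, c2 = m * a2 + e by exists (c2 - m * a2); ring.
have [s b2E] : exists s, b2 = m ^+ 2 * a2 + 2 * m * e + s.
  by exists (b2 - m ^+ 2 * a2 - 2 * m * e); ring.
have [|e0 e1 e2 e3 e4] := @quartic_coef_eq0 _ (c0 ^+ 2 - a0 * b0)
  (2 * c0 * c1 - (a0 * b1 + a1 * b0))
  (2 * c0 * c2 + c1 ^+ 2 - (a0 * b2 + a1 * b1 + a2 * b0))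
  (2 * c1 * c2 - (a1 * b2 + a2 * b1)) (c2 ^+ 2 - a2 * b2).
  by move=> t; have /eqP := h t; rewrite -subr_eq0 => /eqP <-; ring.
have b0E : b0 = m ^+ 2 * a0.
  apply: (mulfI a00); apply/eqP; rewrite -subr_eq0 -oppr_eq0 -e0 c0E.
  by apply/eqP; ring.
have b1E : b1 = m ^+ 2 * a1 + 2 * m * d.
  apply: (mulfI a00); apply/eqP; rewrite -subr_eq0 -oppr_eq0 -e1 c0E c1E b0E.
  by apply/eqP; ring.
have dd : d ^+ 2 = a0 * s.
  by apply/eqP; rewrite -subr_eq0 -e2 c0E c1E c2E b0E b1E b2E; apply/eqP; ring.
have de : 2 * d * e = a1 * s.
  by apply/eqP; rewrite -subr_eq0 -e3 c1E c2E b1E b2E; apply/eqP; ring.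
have ee : e ^+ 2 = a2 * s.
  by apply/eqP; rewrite -subr_eq0 -e4 c2E b2E; apply/eqP; ring.
suff d0 : d = 0 by rewrite c1E d0 c0E; ring.
apply/eqP; rewrite -sqrf_eq0 dd mulf_eq0 (negPf a00) /=.
apply: contraNT disc => s0; apply/eqP; apply: (mulIf s0); apply: (mulIf s0).
have -> : a1 ^+ 2 * s * s = (a1 * s) ^+ 2 by ring.
have -> : 4 * a0 * a2 * s * s = 4 * (a0 * s) * (a2 * s) by ring.
by rewrite -de -dd -ee; ring.
Qed.

Lemma sq_eq_mulM (fT : realFieldType) (k l a0 a1 a2 b0 b1 b2 c0 c1 c2 : fT) :
  (forall t, k * (c0 + c1 * t + c2 * t ^+ 2) ^+ 2 =
     l * ((a0 + a1 * t + a2 * t ^+ 2) * (b0 + b1 * t + b2 * t ^+ 2))) ->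
  k != 0 -> a0 != 0 -> a1 ^+ 2 != 4 * a0 * a2 -> c1 * a0 = c0 * a1.
Proof.
move=> h k0.
apply: (@sq_eq_mul _ _ _ _ (l / k * b0) (l / k * b1) (l / k * b2) _ _ c2).
move=> t; apply: (mulfI k0); rewrite h; field; exact: k0.
Qed.

(** For symmetric F', these are the principal 2 x 2 minors of the matrix with
    entries q_ab(x) / F' a b, where q_ab(x) is the entry (a, b) of
    N D_x F D_x N^T, with the denominators cleared. *)
Definition rank1_pencil (fT : fieldType) (n : nat) (F F' N : 'M[fT]_n) : Prop :=
  forall a b x,
    F' a a * F' b b * hadform F (row a N) (row b N) x x ^+ 2 =
    F' a b ^+ 2 * (hadform F (row a N) (row a N) x x *
                   hadform F (row b N) (row b N) x x).

(** If q_aa restricted to the plane of e_i and y were nondegenerate, every q_ab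
    would be a multiple of q_aa on the line e_i + t y. Written out, this says
    that N maps the vector w with w_j = F i j y_j to a multiple of the column i
    of N. As N is invertible and F i j != 0, y is a multiple of e_i, and then
    the restriction is degenerate after all. *)
Lemma rank1_pencil_diag (fT : realFieldType) (n : nat) (F F' N : 'M[fT]_n)
    (a i : 'I_n) (y : 'rV[fT]_n) :
  F^T = F -> (forall i j, F i j != 0) -> (forall a b, F' a b != 0) ->
  N \in unitmx -> rank1_pencil F F' N -> N a i != 0 ->
  let q := hadform F (row a N) (row a N) in
  q (delta_mx 0 i) y ^+ 2 = q (delta_mx 0 i) (delta_mx 0 i) * q y y.
Proof.
move=> symF nzF nzF' unitN pencil Nai q; apply/eqP; apply: contraT => disc.
pose w : 'cV[fT]_n := \col_j (F i j * y 0 j).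
have prop b : N a i * (N *m w) b 0 = N b i * (N *m w) a 0.
  have wE d : \sum_j F i j * row d N 0 j * y 0 j = (N *m w) d 0.
    by rewrite mxE; apply: eq_bigr => j _; rewrite !mxE; ring.
  pose e : 'rV[fT]_n := delta_mx 0 i.
  pose B c d := hadform F (row c N) (row d N).
  have BC c d : B c d y e = B d c e y by rewrite /B hadformC.
  have h : (B a b e y + B a b y e) * B a a e e =
           B a b e e * (B a a e y + B a a y e).
    apply: (@sq_eq_mulM _ (F' a a * F' b b) (F' a b ^+ 2) _ _ (B a a y y)
      (B b b e e) (B b b e y + B b b y e) (B b b y y) _ _ (B a b y y)).
    - by move=> t; rewrite -!hadform_line pencil.
    - by rewrite mulf_neq0.
    - by rewrite /B hadform_delta !mxE !mulf_neq0.
    apply: contra disc => /eqP disc; apply/eqP; apply: (@mulfI _ 4).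
      by rewrite pnatr_eq0.
    by rewrite /q -/(B a a) -/e [RHS]mulrA -disc BC; ring.
  move: h; rewrite !BC /B /e !hadform_delta !hadform_deltal !wE => h.
  apply: (mulfI Nai); apply: (mulfI Nai); apply: (mulfI (nzF i i)).
  apply/eqP; rewrite -subr_eq0; move/eqP: h; rewrite -subr_eq0 => /eqP <-.
  by apply/eqP; rewrite !mxE; ring.
pose z := N a i *: w - (N *m w) a 0 *: delta_mx i 0.
have z0 : z = 0.
  rewrite -[z](mulKmx unitN) (_ : N *m z = 0) ?mulmx0 //.
  rewrite mulmxBr -!scalemxAr -colE; apply/colP=> b.
  by have := prop b; rewrite !mxE => ->; rewrite mulrC subrr.
have yE : y = y 0 i *: delta_mx 0 i.
  apply/rowP=> j; rewrite !mxE eqxx /=; have [->|ne] := eqVneq j i.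
    by rewrite mulr1.
  have /eqP := congr1 (fun v : 'cV_n => v j 0) z0.
  rewrite !mxE (negPf ne) /= !mulr0 subr0.
  by rewrite !mulf_eq0 (negPf Nai) (negPf (nzF _ _)) => /eqP.
by case/eqP: disc; rewrite yE /q !(hadformZl, hadformZr); ring.
Qed.

(** If N a l = 0, then along y + t e_l the form q_aa is constant and q_ab is
    affine in t. This is the coefficient of t ^ 2 in the vanishing minor. *)
Lemma rank1_pencil_off (fT : realFieldType) (n : nat) (F F' N : 'M[fT]_n)
    (a b l : 'I_n) (y : 'rV[fT]_n) :
  F^T = F -> rank1_pencil F F' N -> N a l = 0 ->
  F' a a * F' b b * hadform F (row a N) (row b N) y (delta_mx 0 l) ^+ 2 =
  F' a b ^+ 2 * (hadform F (row a N) (row a N) y y * (N b l * F l l * N b l)).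
Proof.
move=> symF pencil Nal.
have al0 (v x : 'rV[fT]_n) : hadform F (row a N) v (delta_mx 0 l) x = 0.
  by rewrite hadform_deltal mxE Nal mul0r.
have := pencil a b (y + _ *: delta_mx 0 l) => h.
pose B := hadform F (row a N) (row b N) y (delta_mx 0 l).
pose A := hadform F (row a N) (row a N) y y.
pose q := hadform F (row b N) (row b N).
pose c := hadform F (row a N) (row b N) y y.
have [|_ _ + _ _] := @quartic_coef_eq0 _
  (F' a a * F' b b * c ^+ 2 - F' a b ^+ 2 * A * q y y)
  (2 * F' a a * F' b b * c * B
    - F' a b ^+ 2 * A * (q y (delta_mx 0 l) + q (delta_mx 0 l) y))
  (F' a a * F' b b * B ^+ 2
    - F' a b ^+ 2 * (A * q (delta_mx 0 l) (delta_mx 0 l))) 0 0.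
  move=> t; have /eqP := h t; rewrite -subr_eq0 => /eqP; apply: etrans.
  rewrite !hadform_line !al0.
  rewrite [hadform F _ (row a N) y (delta_mx _ _)]hadformC // al0.
  by rewrite /A /B /q /c; ring.
by move/eqP; rewrite subr_eq0 /q hadform_delta ![row b N _ _]mxE => /eqP.
Qed.

(** A row a of N with two nonzero entries i, j forces the rows i, j of F to be
    proportional. If N a l != 0, compare q_aa being degenerate on the planes of
    e_i with e_j, e_l and e_j + e_l. If N a l = 0, choose b with N b l != 0 and
    compare the coefficients of t ^ 2 along y + t e_l for y = e_i, e_j and
    e_i + e_j. *)
Lemma rank1_pencil_prop (fT : realFieldType) (n : nat) (F F' N : 'M[fT]_n)
    (a i j l : 'I_n) :
  F^T = F -> (forall i j, F i j != 0) -> (forall a b, F' a b != 0) ->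
  N \in unitmx -> rank1_pencil F F' N -> N a i != 0 -> N a j != 0 ->
  F i j * F i l = F i i * F j l.
Proof.
move=> symF nzF nzF' unitN pencil Nai Naj.
have symE k m : F k m = F m k by rewrite -{1}symF mxE.
have [Nal|Nal] := eqVneq (N a l) 0; last first.
  have h y := rank1_pencil_diag y symF nzF nzF' unitN pencil Nai.
  have := (h (delta_mx 0 j), h (delta_mx 0 l),
           h (delta_mx 0 j + 1 *: delta_mx 0 l)).
  rewrite /= hadform_line hadformDr !hadformZr !hadform_delta !mxE.
  rewrite [F l j]symE mul1r.
  case=> [[ej el] ejl].
  have m0 : 2 * N a i * N a i * N a j * N a l != 0.
    by rewrite !mulf_neq0 ?pnatr_eq0.
  by apply: (mulfI m0); lra.
have [b Nbl] : exists b, N b l != 0.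
  apply/existsP; apply: contraT; rewrite negb_exists => /forallP Nl0.
  have : N *m delta_mx l 0 = 0 :> 'cV_n.
    rewrite -colE; apply/colP=> b; rewrite !mxE.
    by apply/eqP; rewrite -[_ == _]negbK.
  move/(congr1 (mulmx (invmx N))); rewrite mulKmx // mulmx0.
  move/(congr1 (fun v : 'cV_n => v l 0)); rewrite !mxE !eqxx => /eqP.
  by rewrite oner_eq0.
have h y := rank1_pencil_off b y symF pencil Nal.
have := (h (delta_mx 0 i), h (delta_mx 0 j),
         h (delta_mx 0 i + 1 *: delta_mx 0 j)).
rewrite /= hadform_line hadformDl !hadformZl !hadform_delta !mxE.
rewrite [F j i]symE mul1r.
case=> [[ei ej] eij].
have k0 : F' a a * F' b b * F i l != 0 by rewrite !mulf_neq0.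
have m0 : 2 * N a i * N a j * N b l * N b l != 0.
  by rewrite !mulf_neq0 ?pnatr_eq0.
have {}eij : F' a a * F' b b * (F i l * F j l) = F' a b ^+ 2 * (F i j * F l l).
  by apply: (mulfI m0); lra.
have m1 : N a i * N a i * N b l * N b l != 0 by rewrite !mulf_neq0.
have {}ei : F' a a * F' b b * F i l ^+ 2 = F' a b ^+ 2 * (F i i * F l l).
  by apply: (mulfI m1); lra.
apply: (mulfI k0).
transitivity (F i j * (F' a a * F' b b * F i l ^+ 2)); first ring.
transitivity (F i i * (F' a a * F' b b * (F i l * F j l))); last ring.
by rewrite ei eij; ring.
Qed.

(** * Monomial matrices and scalings *)

Lemma unitmx_row_neq0 (fT : fieldType) (n : nat) (N : 'M[fT]_n) (a : 'I_n) :
  N \in unitmx -> row a N != 0.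
Proof.
move=> unitN; apply/eqP=> ra0; have := rowE a N; rewrite ra0.
move/(congr1 (mulmx^~ (invmx N))); rewrite mulmxK // mul0mx.
move/(congr1 (fun v : 'rV_n => v 0 a)); rewrite !mxE !eqxx => /eqP.
by rewrite eq_sym oner_eq0.
Qed.

Lemma unitmx_monomial (fT : fieldType) (n : nat) (N : 'M[fT]_n) :
  N \in unitmx -> (forall a i j, N a i != 0 -> N a j != 0 -> i = j) ->
  exists (s : 'S_n) (v : 'rV[fT]_n),
    (forall a, v 0 a != 0) /\ N = diag_mx v *m perm_mx s.
Proof.
move=> unitN one.
have /fin_all_exists[f nzf] a : exists i, N a i != 0.
  by have /rV0Pn[i] := unitmx_row_neq0 a unitN; rewrite mxE; exists i.
have zN a i : i != f a -> N a i = 0.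
  by move=> ne; apply/eqP; apply: contraNT ne => /one/(_ (nzf a)) ->.
have inj_f : injective f.
  move=> a b eq_f; apply/eqP; apply: contraT => ne_ab.
  have := mulmxV unitN; set M := invmx N => NM.
  have rowf c k : (N *m M) c k = N c (f c) * M (f c) k.
    rewrite mxE (bigD1 (f c)) //= big1 ?addr0 // => i ne; by rewrite zN ?mul0r.
  have := rowf b a; rewrite NM -eq_f mxE eq_sym (negPf ne_ab) => /esym/eqP.
  rewrite mulf_eq0 {1}eq_f (negPf (nzf b)) /= => /eqP M0.
  by have := rowf a a; rewrite NM M0 mulr0 mxE eqxx => /eqP; rewrite oner_eq0.
exists (perm inj_f), (\row_a N a (f a)); split=> [a|]; first by rewrite mxE.
apply/matrixP=> a i; rewrite mul_diag_mx !mxE permE.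
by have [<-|ne] := eqVneq (f a) i; rewrite ?mulr1 // mulr0 zN // eq_sym.
Qed.

(** Column by column, H is E rescaled by square roots of the diagonal of Q, with
    signs that may depend on both indices. The ratios H a k / E a k and
    H b k / E b k multiply to Q a b whenever both are defined, which makes Q of
    rank one; the ambiguity left is one sign for each column. A column of E with
    no zero entry would give r directly, but none need exist, so r is read off
    the column c of Q. *)
Lemma common_scaling (fT : fieldType) (n K : nat) (Q : 'M[fT]_n)
    (E H : 'M[fT]_(n, K)) (c : 'I_n) :
  (forall a b, Q a b != 0) ->
  (forall a b k, H a k * H b k = Q a b * (E a k * E b k)) ->
  (forall a b c, exists k, [/\ E a k != 0, E b k != 0 & E c k != 0]) ->
  exists (r : 'rV[fT]_n) (t : 'rV[fT]_K),
    [/\ forall a, r 0 a != 0, forall a b, Q a b = r 0 a * r 0 b,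
        forall k, t 0 k * t 0 k = 1
      & forall a k, H a k = r 0 a * E a k * t 0 k].
Proof.
move=> nzQ HQ exE.
have Q3 a b : Q a b * Q c c = Q a c * Q b c.
  have [k [Ea Eb Ec]] := exE a b c.
  have m0 : E a k * E b k * (E c k * E c k) != 0 by rewrite !mulf_neq0.
  apply: (mulIf m0).
  transitivity (Q a b * (E a k * E b k) * (Q c c * (E c k * E c k))).
    by ring.
  transitivity (Q a c * (E a k * E c k) * (Q b c * (E b k * E c k))).
    by rewrite -!HQ; ring.
  by ring.
have [k0 [Ec _ _]] := exE c c c.
have [u uu] : exists u, u * u = Q c c.
  by exists (H c k0 / E c k0); rewrite mulrACA HQ -invfM mulfK // mulf_neq0.
have u0 : u != 0 by have := nzQ c c; rewrite -uu mulf_eq0 orbb.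
have rr a b : Q a b = Q a c / u * (Q b c / u).
  by rewrite mulrACA -invfM uu -Q3 mulfK.
have /fin_all_exists[t tE] k : exists t, t * t = 1 /\
    forall a, H a k = Q a c / u * E a k * t.
  have HH a b : H a k * H b k = Q a c / u * E a k * (Q b c / u * E b k).
    by rewrite HQ rr; ring.
  have [/existsP[a ga]|/existsPn g0] :=
      boolP [exists a, Q a c / u * E a k != 0].
    set g := fun a => Q a c / u * E a k in ga HH *.
    have Ha : H a k != 0.
      have : H a k * H a k != 0 by rewrite HH mulf_neq0.
      by rewrite mulf_eq0 orbb.
    exists (H a k / g a); split.
      by rewrite mulrACA HH -invfM divff // mulf_neq0.
    move=> b; apply: (mulfI Ha); rewrite HH; rewrite -/(g b).
    transitivity (H a k * H a k * g b / g a); last by ring.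
    by rewrite HH -/(g a) [RHS]mulrAC mulfK.
  (* The column k of E, hence that of H, is zero: any sign will do. *)
  exists 1; split=> [|a]; first exact: mulr1.
  have /negPn/eqP ga := g0 a.
  by apply/eqP; rewrite ga mul0r -[_ == _]orbb -mulf_eq0 HH ga mul0r.
exists (\row_a (Q a c / u)), (\row_k t k).
split=> [a|a b|k|a k]; rewrite !mxE ?mulf_neq0 ?invr_neq0 //.
  by have [] := tE k.
by have [_ ->] := tE k.
Qed.

Lemma nonsing_diag_mx (fT : fieldType) (n : nat) (d : 'rV[fT]_n) :
  (forall i, d 0 i != 0) ->
  nonsing_diag (diag_mx d) /\ invmx (diag_mx d) = diag_mx (map_mx GRing.inv d).
Proof.
move=> nzd; have dd : diag_mx d *m diag_mx (map_mx GRing.inv d) = 1%:M.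
  apply/matrixP=> i j; rewrite mul_diag_mx !mxE.
  by case: eqP => _; rewrite ?mulr0 ?divff.
have [ud _] := mulmx1_unit dd; split.
  by rewrite /nonsing_diag diag_mx_is_diag.
by rewrite -[RHS](mulKmx ud) dd mulmx1.
Qed.

(** * Comparing two decompositions *)

(** The matrices D_x F D_x, for x among the columns of G, span all symmetric
    matrices because F has no zero entry. Hence the slices together span the
    column space of A, and they have their columns in that of A'. The proof
    uses the dual form: whatever kills A' on the left kills A. *)
Lemma dedicom_factor (fT : numFieldType) (I R R' K : nat)
    (T : tensor3 fT I I K) (A : 'M[fT]_(I, R)) F G (A' : 'M[fT]_(I, R')) F' G' :
  is_dedicom T A F G -> is_dedicom T A' F' G' ->
  row_free A^T -> (forall i j, F i j != 0) -> unisolvent 2 G ->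
  exists N, A = A' *m N.
Proof.
move=> [symF TE] [_ TE'] freeA nzF uniG.
suff /submxP[N AN] : (A^T <= A'^T)%MS.
  by exists N^T; rewrite -[A]trmxK AN trmx_mul trmxK.
rewrite submxE -trmx_eq0 trmx_mul trmxK; set C := (cokermx _)^T.
have CA' : C *m A' = 0.
  by apply: trmx_inj; rewrite trmx_mul trmxK mulmx_coker trmx0.
apply/eqP/row_matrixP=> c; rewrite row0; apply/eqP; apply: contraT.
set y := row c _ => y0; have /rV0Pn[j _] := y0; case/eqP: (y0).
apply: (@hadform_eq0 _ _ F y (delta_mx 0 j)) => //; last first.
  apply/eqP=> /(congr1 (fun v : 'rV_R => v 0 j)) /eqP.
  by rewrite !mxE !eqxx oner_eq0.
apply: uniG => [|k]; first exact: is_form_hadform.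
pose D := diag_mx (col k G)^T.
suff CS : C *m A *m D *m F *m D = 0.
  by rewrite hadform_mx /y -!row_mul -/D CS mul0mx row0 mxE.
apply: (row_free_inj freeA); rewrite mul0mx.
have := congr1 (mulmx C) (etrans (esym (TE k)) (TE' k)).
by rewrite !mulmxA CA' !mul0mx.
Qed.

(** Cancelling A' on both sides of a slice leaves N D F D N^T = D' F' D'; this
    is its entry (a, b). *)
Lemma dedicom_change (fT : fieldType) (I R K : nat) (T : tensor3 fT I I K)
    (A A' : 'M[fT]_(I, R)) F G F' G' N :
  is_dedicom T A F G -> is_dedicom T A' F' G' ->
  A = A' *m N -> row_free A'^T ->
  forall a b k,
    hadform F (row a N) (row b N) (col k G)^T (col k G)^T =
    F' a b * (G' a k * G' b k).
Proof.
move=> [_ TE] [_ TE'] AN freeA' a b k.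
have := etrans (esym (TE k)) (TE' k); rewrite {}AN trmx_mul.
set D := diag_mx _; set D' := diag_mx _ => eqT.
have {eqT} eqD : N *m D *m F *m D *m N^T = D' *m F' *m D'.
  apply: trmx_inj; apply: (row_free_inj freeA'); rewrite -!trmx_mul.
  congr _^T; apply: (row_free_inj freeA').
  by move: eqT; rewrite !mulmxA.
have := congr1 (fun M : 'M_R => M a b) eqD.
rewrite hadform_mx -!row_mul tr_row => entry.
transitivity ((N *m D *m F *m D *m N^T) a b).
  by rewrite !mxE; apply: eq_bigr => j _; rewrite [col _ _ _ _]mxE.
by rewrite entry mul_mx_diag mul_diag_mx !mxE; ring.
Qed.

(** At a column of G, dividing by F' a b leaves the rank one matrix with entries
    G' a k G' b k, so the minors vanish there; being quartic, they vanish
    everywhere. *)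
Lemma dedicom_rank1_pencil (fT : realFieldType) (n K : nat)
    (F F' N : 'M[fT]_n) (G G' : 'M[fT]_(n, K)) :
  unisolvent 4 G ->
  (forall a b k,
    hadform F (row a N) (row b N) (col k G)^T (col k G)^T =
    F' a b * (G' a k * G' b k)) ->
  rank1_pencil F F' N.
Proof.
move=> uniG eqT a b x; apply/eqP; rewrite -subr_eq0 -mulNr expr2; apply/eqP.
pose q c d (z : 'rV[fT]_n) := hadform F (row c N) (row d N) z z.
have qf c d : is_form 2 (q c d) by exact: is_form_hadform.
have fd := is_formD (is_formZ (F' a a * F' b b) (is_formM (qf a b) (qf a b)))
                    (is_formZ (- F' a b ^+ 2) (is_formM (qf a a) (qf b b))).
by apply: (uniG _ fd) => k; rewrite /q !eqT; ring.
Qed.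

(** If F' a b = 0, the form q_ab vanishes at the columns of G, hence everywhere,
    which makes a row of N zero. *)
Lemma dedicom_change_neq0 (fT : realFieldType) (n K : nat)
    (F F' N : 'M[fT]_n) (G G' : 'M[fT]_(n, K)) :
  F^T = F -> (forall i j, F i j != 0) -> unisolvent 2 G -> N \in unitmx ->
  (forall a b k,
    hadform F (row a N) (row b N) (col k G)^T (col k G)^T =
    F' a b * (G' a k * G' b k)) ->
  forall a b, F' a b != 0.
Proof.
move=> symF nzF uniG unitN eqT a b; apply/eqP=> F'0.
have/eqP := unitmx_row_neq0 a unitN; apply.
apply: (@hadform_eq0 _ _ F _ (row b N)) => //; last exact: unitmx_row_neq0.
by apply: uniG => [|k]; [exact: is_form_hadform | rewrite eqT F'0 mul0r].
Qed.

Lemma rank1_pencil_monomial (fT : realFieldType) (n : nat)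
    (F F' N : 'M[fT]_n) :
  F^T = F -> (forall i j, F i j != 0) -> (forall a b, F' a b != 0) ->
  (forall i j c, i != j -> col j F <> c *: col i F) ->
  N \in unitmx -> rank1_pencil F F' N ->
  forall a i j, N a i != 0 -> N a j != 0 -> i = j.
Proof.
move=> symF nzF nzF' colF unitN pencil a i j Nai Naj.
apply/eqP; apply: contraT => ne_ij.
case: (colF i j (F i j / F i i) ne_ij); apply/colP=> l; rewrite !mxE.
have symE k m : F k m = F m k by rewrite -{1}symF mxE.
apply: (mulfI (nzF i i)); rewrite [F l j]symE [F l i]symE.
rewrite -(rank1_pencil_prop l symF nzF nzF' unitN pencil Nai Naj).
by rewrite mulrA mulrCA divff ?mulr1.
Qed.

(** Here N = diag(v) s with s a permutation, and G' is compared by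
    [common_scaling] with the rows of G permuted by s and scaled by v. *)
Theorem dedicom_unique (fT : realFieldType) (I R K : nat) (T : tensor3 fT I I K)
    (A : 'M[fT]_(I, R)) (F : 'M[fT]_R) (G : 'M[fT]_(R, K)) :
  is_dedicom T A F G -> \rank A = R -> (forall i j, F i j != 0) ->
  (forall i j c, i != j -> col j F <> c *: col i F) -> unisolvent 4 G ->
  (0 < R)%N -> essentially_unique T A F G.
Proof.
move=> TA rkA nzF colF uniG R0 A' F' G' TA'.
have [symF _] := TA.
have freeA : row_free A^T by rewrite /row_free mxrank_tr rkA.
have uniG2 := unisolvent2 uniG.
have [N AN] := dedicom_factor TA TA' freeA nzF uniG2.
have unitN : N \in unitmx.
  by rewrite -row_full_unit -col_leq_rank -{1}rkA AN mxrankM_maxr.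
have freeA' : row_free A'^T.
  by rewrite -row_leq_rank mxrank_tr -{1}rkA AN mxrankM_maxl.
have eqT := dedicom_change TA TA' AN freeA'.
have nzF' := dedicom_change_neq0 symF nzF uniG2 unitN eqT.
have pencil := dedicom_rank1_pencil uniG eqT.
have [s [v [nzv NE]]] := unitmx_monomial unitN
  (rank1_pencil_monomial symF nzF nzF' colF unitN pencil).
pose c : 'I_R := Ordinal R0.
pose Q : 'M[fT]_R := \matrix_(a, b) (F (s a) (s b) / F' a b).
pose E : 'M[fT]_(R, K) := \matrix_(a, k) (v 0 a * G (s a) k).
have rowN a : row a N = v 0 a *: delta_mx 0 (s a).
  apply/rowP=> i; rewrite NE mul_diag_mx !mxE eqxx /=; congr (_ * _).
  by rewrite eq_sym.
have [|||r [t [nzr Qr tt G'E]]] := @common_scaling _ _ _ Q E G' c.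
- by move=> a b; rewrite mxE mulf_neq0 ?invr_eq0.
- move=> a b k; apply: (mulfI (nzF' a b)); rewrite -eqT !rowN hadform_swap.
  rewrite !(hadformZl, hadformZr) hadform_delta !mxE; field; apply: nzF'.
- move=> a b d; have [k [Ga Gb Gd]] := unisolvent4_neq0 (s a) (s b) (s d) uniG.
  by exists k; rewrite !mxE !mulf_neq0.
pose d := \row_i r 0 ((s^-1)%g i).
have nzd i : d 0 i != 0 by rewrite mxE.
have nzw a : map_mx GRing.inv v 0 a != 0 by rewrite mxE invr_eq0.
have nzt k : t 0 k != 0.
  by have/eqP := tt k; apply: contraTneq => ->; rewrite mul0r eq_sym oner_eq0.
have [LAn LAi] := nonsing_diag_mx nzw.
have [LGn LGi] := nonsing_diag_mx nzd.
have [Ltn Lti] := nonsing_diag_mx nzt.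
have PT : (perm_mx s^-1)^T = perm_mx s :> 'M[fT]_R by rewrite tr_perm_mx invgK.
have ti : map_mx GRing.inv t = t.
  by apply/rowP=> k; rewrite mxE; apply: (mulfI (nzt k)); rewrite tt divff.
have A'E : A' = A *m perm_mx s^-1 *m diag_mx (map_mx GRing.inv v).
  rewrite AN NE -!mulmxA [perm_mx s *m _]mulmxA -perm_mxM mulgV perm_mx1.
  rewrite mul1mx mulmx_diag (_ : diag_mx _ = 1%:M) ?mulmx1 //.
  by apply/matrixP=> i j; rewrite !mxE divff.
have G'E' : G' = invmx (diag_mx (map_mx GRing.inv v)) *m (perm_mx s^-1)^T
                  *m diag_mx d *m G *m diag_mx t.
  apply/matrixP=> a k; rewrite PT LAi -!mulmxA mul_diag_mx -row_permE.
  by rewrite mul_diag_mx mul_mx_diag G'E !mxE permK invrK; ring.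
exists (perm_mx s^-1), (diag_mx (map_mx GRing.inv v)),
  (diag_mx (map_mx GRing.inv v)), (diag_mx d), (diag_mx d), (diag_mx t).
split=> //.
- exact: perm_mx_is_perm.
- rewrite PT LGi; apply/matrixP=> a b.
  rewrite -!mulmxA -row_permE mul_diag_mx.
  rewrite mulmxA mul_mx_diag -col_permE !mxE !permK.
  have -> : F (s a) (s b) = r 0 a * r 0 b * F' a b.
    by rewrite -Qr mxE divfK.
  by field; rewrite !nzr.
by rewrite Lti ti.
Qed.

Theorem proposition6p5 (rT : realType) (I R K : nat) (T : tensor3 rT I I K)
    (A : 'M[rT]_(I, R)) (F : 'M[rT]_R) (G : 'M[rT]_(R, K))
    (hT : is_dedicom T A F G)
    (hA : \rank A = R)
    (hF : forall i j : 'I_R, F i j != 0)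
    (hG : \rank (khatri_rao (khatri_rao (khatri_rao G G) G) G) = 'C(R + 3, 4))
    (hkF : (2 <= krank F)%N)
    (hkFT : (2 <= krank F^T)%N) :
  essentially_unique T A F G /\
  forall (R' : nat), (R' < R)%N ->
    ~ exists (A' : 'M[rT]_(I, R')) (F' : 'M[rT]_R') (G' : 'M[rT]_(R', K)),
        is_dedicom T A' F' G'.
Proof.
have uniG := unisolvent4 hG.
split.
  apply: dedicom_unique => // [i j c|]; first exact: krank_ge2_col.
  have krank_le : (krank F <= R)%N by apply/bigmax_leqP => k _; rewrite -ltnS.
  by apply: leq_trans krank_le; apply: ltnW.
move=> R' ltR [A' [F' [G' TA']]].
have freeA : row_free A^T by rewrite /row_free mxrank_tr hA.
have [N AN] := dedicom_factor hT TA' freeA hF (unisolvent2 uniG).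
have := leq_trans (mxrankM_maxl A' N) (rank_leq_col A').
by rewrite -AN hA leqNgt ltR.
Qed.
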